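(* For each $s$ let $E(s)=\mathrm{Span}_{\mathbb{F}_8}\{\mathrm{ev}(M+I_8)\mid M\in\Delta,\ \delta(M)\ge s\}\subseteq\mathbb{F}_8^{22}$, where $I_8$, $\Delta$, $\mathrm{ev}$ and $\delta$ are defined in the context. Then for each pair $(k,d)$ in the list $$(1,22),(2,19),(3,18),(4,16),(5,15),(7,13),(8,12),(10,10),(11,9),(13,7),(14,6),(15,5),(17,4),(18,3),(20,2),$$ the code $E(d)$ is a linear code over $\mathbb{F}_8$ of length $22$, of dimension exactly $k$, and of minimum distance at least $d$.
   Context: Let $I_8=\langle Y^3+X^3Y+X,\ X^8+X,\ Y^8+Y\rangle\subseteq\mathbb{F}_8[X,Y]$ (Klein quartic). Its variety over $\mathbb{F}_8$ consists of $22$ distinct points $P_1,\dots,P_{22}$. The evaluation map is $\mathrm{ev}:\mathbb{F}_8[X,Y]/I_8\to\mathbb{F}_8^{22}$, $\mathrm{ev}(F+I_8)=(F(P_1),\dots,F(P_{22}))$. The monomial ordering $\prec_w$ is given by: $X^\alpha Y^\beta\prec_w X^\gamma Y^\delta$ if either $2\alpha+3\beta<2\gamma+3\delta$, or $2\alpha+3\beta=2\gamma+3\delta$ and $\beta<\delta$. The footprint $\Delta=\Delta_{\prec_w}(I_8)$ is the set of monomials that are not the leading monomial (with respect to $\prec_w$) of any polynomial in $I_8$; explicitly $$\Delta=\{X^i\mid 0\le i\le 7\}\cup\{X^iY\mid 0\le i\le 6\}\cup\{X^iY^2\mid 0\le i\le 6\},$$ which has $22$ elements. The function $\delta:\Delta\to\mathbb{N}$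 is given by the following values: - $\delta(X^i)$ for $i=0,1,\dots,7$: $22,19,16,13,10,7,4,1$; - $\delta(X^iY)$ for $i=0,1,\dots,6$: $18,15,12,9,6,4,2$; - $\delta(X^iY^2)$ for $i=0,1,\dots,6$: $13,10,7,5,3,2,1$. *)

(* Defs.v *)
From HB Require Import structures.
From mathcomp Require Import all_boot all_order all_algebra.
From mathcomp Require Import boolp mpoly.

Set Implicit Arguments.
Unset Strict Implicit.
Unset Printing Implicit Defensive.

Import Order.TTheory GRing.Theory.
Local Open Scope ring_scope.

(* X and Y are the indeterminates of index 0 and 1, so the monomial
   X^a Y^b is the m : 'X_{1..2} with m iX = a and m iY = b. *)
Definition iX : 'I_2 := ord0.
Definition iY : 'I_2 := ord_max.

Section KleinQuartic.

Variable F : finFieldType.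
Notation Rxy := {mpoly F[2]}.

Definition klein_quartic : Rxy := 'X_iY ^+ 3 + 'X_iX ^+ 3 * 'X_iY + 'X_iX.

Definition klein_ideal (f : Rxy) : Prop :=
  exists a b c : Rxy,
    f = a * klein_quartic + b * ('X_iX ^+ 8 + 'X_iX)
      + c * ('X_iY ^+ 8 + 'X_iY).

Definition klein_variety : {set 2.-tuple F} :=
  [set p : 2.-tuple F | `[< forall f, klein_ideal f -> f.@[tnth p] = 0 >]].

(* A map on polynomials rather than on F[X,Y]/I_8: by ev_klein_ideal below,
   its value depends only on the residue class of f. *)
Definition ev n (P : 'I_n -> 2.-tuple F) (f : Rxy) : 'rV[F]_n :=
  \row_(i < n) f.@[tnth (P i)].

Lemma ev_klein_ideal n (P : 'I_n -> 2.-tuple F) (f g : Rxy) :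
  (forall i, P i \in klein_variety) -> klein_ideal (f - g) -> ev P f = ev P g.
Proof.
move=> PV Ifg; apply/rowP => i; rewrite !mxE; apply/eqP.
rewrite -subr_eq0 -mevalB; apply/eqP.
by have := PV i; rewrite inE => /asboolP; apply.
Qed.

End KleinQuartic.

Definition wdeg (m : 'X_{1..2}) : nat := (2 * m iX + 3 * m iY)%N.

Definition prec_w (m n : 'X_{1..2}) : bool :=
  (wdeg m < wdeg n)%N || (wdeg m == wdeg n) && (m iY < n iY)%N.

Definition is_lead_mon (F : finFieldType) (f : {mpoly F[2]}) (m : 'X_{1..2})
    : Prop :=
  m \in msupp f /\ (forall n, n \in msupp f -> n != m -> prec_w n m).

Definition footprint (F : finFieldType) (m : 'X_{1..2}) : Prop :=
  ~ (exists f : {mpoly F[2]}, klein_ideal f /\ is_lead_mon f m).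

(* Row b, column a is the value at X^a Y^b. *)
Definition delta_table : seq (seq nat) :=
  [:: [:: 22; 19; 16; 13; 10; 7; 4; 1];
      [:: 18; 15; 12; 9; 6; 4; 2];
      [:: 13; 10; 7; 5; 3; 2; 1]]%N.

(* Extended by 0 outside the footprint, where it is never used. *)
Definition delta (m : 'X_{1..2}) : nat :=
  nth 0%N (nth [::] delta_table (m iY)) (m iX).

Definition code_gen (F : finFieldType) (P : 'I_22 -> 2.-tuple F) (s : nat)
    (v : 'rV[F]_22) : Prop :=
  exists m : 'X_{1..2},
    [/\ footprint F m, (s <= delta m)%N & v = ev P 'X_[m]].

Definition code (F : finFieldType) (P : 'I_22 -> 2.-tuple F) (s : nat)
    : {vspace 'rV[F]_22} :=
  <<[seq v <- enum {: 'rV[F]_22} | `[< code_gen P s v >]]>>%VS.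

Definition hamming_dist (F : finFieldType) n (u v : 'rV[F]_n) : nat :=
  #|[set i | u 0 i != v 0 i]|.

(* Every Hamming distance is at most n, so the default value n of the minimum
   only matters for the zero code. *)
Definition min_dist (F : finFieldType) n (C : {vspace 'rV[F]_n}) : nat :=
  \big[Order.min/n]_(uv : 'rV[F]_n * 'rV[F]_n |
      [&& uv.1 \in C, uv.2 \in C & uv.1 != uv.2])
    hamming_dist uv.1 uv.2.

(* Main.v *)
Require Import Defs.
From mathcomp Require Import all_boot all_order all_algebra all_field.
From mathcomp Require Import boolp mpoly.
From mathcomp Require Import ring zify.

(** Write x, y for the coordinate functions of the projective Klein quartic; its
    24 rational points over F_8 are the 22 affine ones and two at infinity,
    Q1 = (1:0:0) and Q2 = (0:1:0), with
      div x = 3 P00 - Q1 - 2 Q2,   div y = P00 + 2 Q1 - 3 Q2.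
    For x <> 0 the affine points are (x, x^5 t) with t^3 + t + 1 = 0. Hence a
    combination of footprint monomials that vanishes at all of them is, for every
    x <> 0, a polynomial of degree at most 2 in y with three roots; so the 22
    monomials form a basis of the functions on the 22 points, and everything that
    follows is linear algebra over F_2 in this basis.

    Minimum distance. Fix functionals phi_l that are the coordinates in a basis
    of functions regular outside Q2, ordered by pole order at Q2. Generate the
    code by functions with distinct pole orders at Q2. If f is a codeword whose
    leading generator is b, multiply f by functions g that vanish at Q1 to an order
    that absorbs the poles of the code there: the leading positions of the products
    f g are those of b g. Choosing g_1, ..., g_d with d distinct leading positions
    l_1, ..., l_d makes the matrix of the phi_{l_j}(f g_k) triangular and
    invertible, and its rank is at most the weight of f because it factors
    through diag(f). *)

(** * Finite data over F_2 and their verification *)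

(* The pair (a, b) stands for X^a Y^b, and a list of pairs for the sum of its
   monomials, with coefficients in F_2. *)
Definition deltas : seq (nat * nat) :=
  [seq (i, 0) | i <- iota 0 8] ++
  [seq (i, 1) | i <- iota 0 7] ++ [seq (i, 2) | i <- iota 0 7].

Definition delta_of (m : nat * nat) : nat :=
  nth 0 (nth [::] delta_table m.2) m.1.

(* Row b, column a lists the positions l at which X^a Y^b has coordinate 1 in a
   basis of monomials regular outside Q2: the basis elements of positions
   0, ..., 21 have the pole orders 25, 23, 22, ..., 5, 3, 0 at Q2. *)
Definition flag_table : seq (seq (seq nat)) :=
  [:: [:: [:: 21]; [:: 8; 1]; [:: 6; 0]; [:: 18; 11; 4]; [:: 16; 9; 2];
          [:: 20; 7]; [:: 19; 5]; [:: 17; 3]];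
      [:: [:: 20]; [:: 19]; [:: 17]; [:: 15; 8; 1]; [:: 13; 6; 0];
          [:: 18; 4]; [:: 16; 2]];
      [:: [:: 18]; [:: 16]; [:: 14]; [:: 12]; [:: 10]; [:: 15; 1];
          [:: 13; 0]]].

(* Reduction by y^3 = x^3 y + x, and by x^7 m = m for every monomial m <> 1;
   positions are repeated, only their parity matters. *)
Fixpoint flag_pos (a b : nat) {struct b} : seq nat :=
  match b with
  | (b1.+1 as b2).+2 => flag_pos (a + 3) b2 ++ flag_pos a.+1 b1
  | 0 => nth [::] (nth [::] flag_table 0)
           (if a is a1.+1 then (a1 %% 7).+1 else 0)
  | _ => nth [::] (nth [::] flag_table b) (a %% 7)
  end.

Definition flag_bit (p : seq (nat * nat)) (l : nat) : bool :=
  odd (count_mem l (flatten [seq flag_pos m.1 m.2 | m <- p])).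

(* [find (flag_bit p) (iota 0 22)], with the list of positions shared. *)
Definition flag_lead (p : seq (nat * nat)) : nat :=
  let s := flatten [seq flag_pos m.1 m.2 | m <- p] in
  find (fun l => odd (count_mem l s)) (iota 0 22).

Definition pmul (p q : seq (nat * nat)) : seq (nat * nat) :=
  [seq (m.1 + n.1, m.2 + n.2) | m <- p, n <- q].

(* On the curve 1 + x^2 y = y^3 / x has a zero of order 7 at Q1 and a pole of
   order 7 at Q2. *)
Definition multipliers : seq (seq (nat * nat)) :=
  [seq [:: (i, j)] | i <- iota 0 8, j <- iota 0 3] ++
  [seq [:: (i, j); (i.+2, j.+1)] | i <- iota 0 8, j <- iota 0 3].

(* In increasing pole order at Q2. On the curve y^2 + x^3 = x / y and
   x^2 y^2 + x^5 + y = x / y^2 vanish at Q2; they and their multiples by x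
   separate pairs of monomials that have equal pole orders at Q2. *)
Definition pole_basis : seq (seq (nat * nat)) :=
  [:: [:: (2, 2); (5, 0); (0, 1)]; [:: (3, 2); (6, 0); (1, 1)];
      [:: (0, 2); (3, 0)]; [:: (0, 0)]; [:: (1, 2); (4, 0)];
      [:: (1, 0)]; [:: (0, 1)]; [:: (2, 0)]; [:: (1, 1)]; [:: (3, 0)];
      [:: (2, 1)]; [:: (4, 0)]; [:: (3, 1)]; [:: (5, 0)]; [:: (4, 1)];
      [:: (6, 0)]; [:: (5, 1)]; [:: (4, 2)]; [:: (6, 1)]; [:: (5, 2)]].

(* E(5) contains X^3 Y^2 but not X^6, so X^3 Y^2 is needed there on its own. *)
Definition code_basis (d : nat) : seq (seq (nat * nat)) :=
  [seq p <- pole_basis | all (fun m => d <= delta_of m) p] ++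
  (if d == 5 then [:: [:: (3, 2)]] else [::]).

Definition leads (d : nat) : seq (seq nat) :=
  [seq [seq flag_lead (pmul p g) | g <- multipliers] | p <- code_basis d].

(** The candidates for l_1, ..., l_d when generator [i] leads the codeword; 22 is the value of
    [flag_lead] when no bit is set. *)
Definition pivots (L : seq (seq nat)) (i : nat) : seq nat :=
  undup [seq nth 0 (nth [::] L i) k | k <- iota 0 (size multipliers) &
    (nth 0 (nth [::] L i) k < 22) &&
    all (fun j => nth 0 (nth [::] L i) k < nth 0 (nth [::] L j) k) (iota 0 i)].

Definition enough_pivots (d : nat) : bool :=
  let L := leads d in all (fun i => d <= size (pivots L i)) (iota 0 (size L)).

Definition code_mons (d : nat) : seq (nat * nat) :=
  [seq m <- deltas | d <= delta_of m].

Definition spans_code (d : nat) : bool :=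
  all (fun m => has (fun p => (m \in p) &&
                     all (fun n => [:: n] \in code_basis d) (rem m p))
                    (code_basis d))
      (code_mons d).

Lemma codes_checked :
  all (fun kd => [&& size (code_mons kd.2) == kd.1, kd.2 <= 22,
                     spans_code kd.2 & enough_pivots kd.2])
    [:: (1, 22); (2, 19); (3, 18); (4, 16); (5, 15); (7, 13);
        (8, 12); (10, 10); (11, 9); (13, 7); (14, 6); (15, 5);
        (17, 4); (18, 3); (20, 2)].
Proof. by vm_compute. Qed.

(** * Hamming weight bounded below by a matrix rank *)

Section Weight.
Set Implicit Arguments.
Unset Strict Implicit.
Import GRing.Theory.
Local Open Scope ring_scope.

Lemma poly_many_roots0 (R : idomainType) (p : {poly R}) (rs : seq R) :
  uniq rs -> all (root p) rs -> (size p <= size rs)%N -> p = 0.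
Proof.
move=> urs rootp szp; apply/eqP; apply: contraLR szp => p0.
by rewrite -ltnNge max_poly_roots.
Qed.

Lemma mxrank_sum_le (K : fieldType) m n (I : finType) (P : pred I)
    (A : I -> 'M[K]_(m, n)) :
  (\rank (\sum_(i | P i) A i)%R <= \sum_(i | P i) \rank (A i))%N.
Proof.
elim/big_rec2: _ => [|i r B _ leBr]; first by rewrite mxrank0.
by rewrite (leq_trans (mxrank_add _ _)) // leq_add2l.
Qed.

Lemma rank_diag_mx_le (K : fieldType) n (c : 'rV[K]_n) :
  (\rank (diag_mx c) <= #|[set i | c 0%R i != 0%R]|)%N.
Proof.
have -> : diag_mx c = \sum_(i | c 0 i != 0) c 0 i *: delta_mx i i.
  rewrite diag_mx_sum_delta (bigID (fun i => c 0 i != 0)) /=.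
  rewrite [X in _ + X]big1 ?addr0 //.
  by move=> i; rewrite negbK => /eqP ->; rewrite scale0r.
apply: leq_trans (mxrank_sum_le _ _) _.
rewrite -sum1dep_card; apply: leq_sum => i ci.
by rewrite (leq_trans (mxrank_scale _ _)) // mxrank_delta.
Qed.

Lemma weight_ge_triangular (K : fieldType) n (c : 'rV[K]_n) (s : seq nat)
    (phi : nat -> 'cV[K]_n) (g : nat -> 'rV[K]_n) :
    sorted ltn s ->
    {in s, forall l, \sum_i c 0 i * g l 0 i * phi l i 0 != 0} ->
    {in s &, forall l k, (k < l)%N ->
       \sum_i c 0 i * g l 0 i * phi k i 0 = 0} ->
  (size s <= #|[set i | c 0%R i != 0%R]|)%N.
Proof.
move=> srt nz z.
pose A : 'M[K]_(size s, n) := \matrix_(j, i) phi (nth 0%N s j) i 0.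
pose B : 'M[K]_(n, size s) := \matrix_(i, j) g (nth 0%N s j) 0 i.
pose M := A *m diag_mx c *m B.
have ME j k : M j k =
    \sum_i c 0 i * g (nth 0%N s k) 0 i * phi (nth 0%N s j) i 0.
  rewrite mxE; apply: eq_bigr => i _.
  by rewrite mul_mx_diag !mxE; ring.
have triM : is_trig_mx M.
  apply/is_trig_mxP => j k ltjk; rewrite ME z ?mem_nth //.
  by rewrite (sorted_ltn_nth ltn_trans) ?inE.
have /mxrank_unit <- : M \in unitmx.
  rewrite unitmxE det_trig // unitfE; apply/prodf_neq0 => i _.
  by rewrite ME nz ?mem_nth.
apply: leq_trans (rank_diag_mx_le c).
by rewrite (leq_trans (mxrankM_maxl _ _)) ?mxrankM_maxr.
Qed.

End Weight.

(** * Rational points of the Klein quartic over F_8 *)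

Section Curve.
Set Implicit Arguments.
Unset Strict Implicit.
Import GRing.Theory.
Local Open Scope ring_scope.

Variable F : finFieldType.
Hypothesis cardF : #|F| = 8%N.

Lemma pchar2 : 2 \in [pchar F].
Proof. by have := card_finPcharP (F := F) (p := 2) (n := 3) cardF isT. Qed.

Lemma expf8 (x : F) : x ^+ 8 = x.
Proof. by have := expf_card x; rewrite cardF. Qed.

Lemma expf7 (x : F) : x != 0 -> x ^+ 7 = 1.
Proof. by move=> x0; apply: (mulfI x0); rewrite -exprS expf8 mulr1. Qed.

Definition on_curve (x y : F) := y ^+ 3 + x ^+ 3 * y + x == 0.

Lemma meval_klein (v : 'I_2 -> F) :
  (klein_quartic F).@[v] = v iY ^+ 3 + v iX ^+ 3 * v iY + v iX.
Proof. by rewrite /klein_quartic !(mevalD, mevalM, rmorphXn) /= !mevalXU. Qed.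

Lemma klein_ideal_quartic : klein_ideal (klein_quartic F).
Proof. by exists 1, 0, 0; rewrite !mul0r !addr0 mul1r. Qed.

(** X^8 + X and Y^8 + Y vanish at every point over F_8, since x^8 = x and 2 = 0. *)
Lemma mem_klein_variety (p : 2.-tuple F) :
  (p \in klein_variety F) = on_curve (tnth p iX) (tnth p iY).
Proof.
rewrite inE; apply/asboolP/eqP => [|onp f [a [b [c ->]]]].
  by move/(_ _ klein_ideal_quartic); rewrite meval_klein.
rewrite 2!mevalD !mevalM meval_klein onp !(mevalD, rmorphXn) /= !mevalXU !expf8.
by rewrite !(addrr_pchar2 pchar2) !mulr0 !addr0.
Qed.

Definition cubic_roots := [set t : F | t ^+ 3 + t + 1 == 0].

Lemma card_cubic_roots : #|cubic_roots| = 3%N.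
Proof.
pose p : {poly F} := 'X^3 + 'X + 1.
have szp : size p = 4%N.
  by rewrite /p -addrA size_polyDl size_polyXn // size_XaddC.
have pchar2P : 2 \in [pchar {poly F}] by rewrite pchar_poly pchar2.
have /dvdp_prod_XsubC [m eqp] : p %| \prod_(x : F) ('X - x%:P).
  rewrite -finField_genPoly cardF; apply/dvdpP.
  (* The cofactor is X (X + 1) (X^3 + X^2 + 1), the product of the other factors of X^8 - X over
     F_2. *)
  exists ('X^5 + 'X^3 + 'X^2 + 'X); apply/eqP; rewrite -subr_eq0.
  have -> : 'X^8 - 'X - ('X^5 + 'X^3 + 'X^2 + 'X) * p =
    - (('X^6 + 'X^5 + 'X^4 + 'X^3 + 'X^2 + 'X) *+ 2) by rewrite /p; ring.
  by rewrite mulr2n (addrr_pchar2 pchar2P) oppr0.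
set s := mask m _ in eqp.
have us : uniq s by rewrite mask_uniq // index_enum_uniq.
have : size s = 3%N by have := eqp_size eqp; rewrite szp size_prod_XsubC => -[].
rewrite -(card_uniqP us) => <-; apply: eq_card => t.
rewrite inE -root_prod_XsubC -(eqp_root eqp) /root /p.
by rewrite !hornerE.
Qed.

(** Since x^7 = 1, substituting y = x^5 t turns the equation into x (t^3 + t + 1) = 0. *)
Lemma on_curve_param (x t : F) :
  x != 0 -> on_curve x (x ^+ 5 * t) = (t \in cubic_roots).
Proof.
move=> x0; rewrite /on_curve inE.
have -> : (x ^+ 5 * t) ^+ 3 + x ^+ 3 * (x ^+ 5 * t) + x =
          (x ^+ 7) ^+ 2 * x * t ^+ 3 + x ^+ 7 * x * t + x by ring.
rewrite expf7 // expr1n !mul1r -{3}[x]mulr1 -!mulrDr mulf_eq0.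
by rewrite (negPf x0).
Qed.

(** The origin is the only point with x = 0; the others are the 7 * 3 points (x, x^5 t). *)
Lemma card_klein_variety : #|klein_variety F| = 22%N.
Proof.
pose h (q : F * F) : 2.-tuple F := [tuple q.1; q.1 ^+ 5 * q.2].
have h0 y : ([tuple 0; y] \in h @: setX [set~ 0] cubic_roots) = false.
  apply/imsetP => -[[u v]]; rewrite !inE /= => /andP[/negPf u0 _] [] /esym/eqP.
  by rewrite u0.
have tE x y :
    ([tuple x; y] == [tuple 0; 0] :> 2.-tuple F) = (x == 0) && (y == 0).
  by apply/eqP/andP => [[-> ->] | [/eqP-> /eqP->]].
have pE (p : 2.-tuple F) : p = [tuple tnth p iX; tnth p iY].
  by apply: eq_from_tnth => -[[|[|//]] i]; rewrite !(tnth_nth 0) /=.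
have -> : klein_variety F = [tuple 0; 0] |: h @: setX [set~ 0] cubic_roots.
  apply/setP => p; rewrite mem_klein_variety in_setU1.
  move: (tnth p iX) (tnth p iY) (pE p) => x y -> {p}; rewrite tE.
  have [-> | x0] := eqVneq x 0.
    by rewrite h0 orbF /on_curve expr0n mul0r !addr0 expf_eq0.
  have -> : y = x ^+ 5 * (y / x ^+ 5)
    by rewrite mulrC divfK // expf_eq0 (negPf x0).
  rewrite on_curve_param //=; set t := y / _.
  apply/idP/imsetP => [tT | [[u v]]].
    by exists (x, t) => //; rewrite in_setX /= tT andbT !inE.
  rewrite in_setX => /andP[/= _ vT] [<- /mulfI]; rewrite expf_eq0 (negPf x0).
  by move=> /(_ isT) ->.
rewrite cardsU1 h0 card_in_imset.
  by rewrite cardsX cardsC1 cardF card_cubic_roots.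
move=> [x t] [u v]; rewrite !inE /= => /andP[x0 _] _ [<- /mulfI].
by rewrite expf_eq0 (negPf x0) => /(_ isT) ->.
Qed.

End Curve.

(** * The 22 monomials as a basis of the functions on the points *)

Section Coordinates.
Set Implicit Arguments.
Unset Strict Implicit.
Import GRing.Theory.
Local Open Scope ring_scope.

Variable F : finFieldType.
Hypothesis cardF : #|F| = 8%N.

Lemma deltas_independent (a : nat * nat -> F) :
    (forall x y, on_curve x y ->
       \sum_(m <- deltas) a m * (x ^+ m.1 * y ^+ m.2) = 0) ->
  {in deltas, forall m, a m = 0}.
Proof.
move=> ev0.
pose p n j : {poly F} := \poly_(i < n) a (i, j).
have rowE x y n j :
    \sum_(m <- [seq (i, j) | i <- iota 0 n]) a m * (x ^+ m.1 * y ^+ m.2) =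
    (p n j).[x] * y ^+ j.
  rewrite big_map -[X in iota _ X]subn0 big_mkord horner_poly mulr_suml.
  by apply: eq_bigr => i _; rewrite mulrA.
have sumE x y : \sum_(m <- deltas) a m * (x ^+ m.1 * y ^+ m.2) =
    (p 8 0%N).[x] + (p 7 1%N).[x] * y + (p 7 2%N).[x] * y ^+ 2.
  by rewrite !big_cat !rowE /= mulr1 addrA.
have p_eq0 x : x != 0 ->
    [/\ (p 8 0%N).[x] = 0, (p 7 1%N).[x] = 0 & (p 7 2%N).[x] = 0].
  move=> x0; pose q := Poly [:: (p 8 0%N).[x]; (p 7 1%N).[x]; (p 7 2%N).[x]].
  have q0 : q = 0.
    apply: (@poly_many_roots0 _ _ [seq x ^+ 5 * t | t <- enum (cubic_roots F)]).
    - have x5 : x ^+ 5 != 0 by rewrite expf_eq0 (negPf x0).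
      by rewrite map_inj_uniq ?enum_uniq //; exact: mulfI x5.
    - apply/allP => y /mapP [t]; rewrite mem_enum => tT -> {y}.
      rewrite /root horner_Poly /= mul0r add0r.
      have := ev0 x (x ^+ 5 * t); rewrite on_curve_param // sumE => /(_ tT) e.
      by apply/eqP; rewrite -[RHS]e; ring.
    - by rewrite size_map -cardE card_cubic_roots // size_Poly.
  have c k : q`_k = 0 by rewrite q0 coef0.
  by split; [have := c 0%N | have := c 1%N | have := c 2]; rewrite coef_Poly.
have nz_roots n j :
    (forall x, x != 0 -> (p n j).[x] = 0) -> (n <= 7)%N -> p n j = 0.
  move=> r0 n7; apply: (@poly_many_roots0 _ _ (enum [set~ (0 : F)])).
  - exact: enum_uniq.
  - by apply/allP => x; rewrite mem_enum !inE /root => /r0 ->.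
  - by rewrite -cardE cardsC1 cardF (leq_trans (size_poly _ _)).
have p1 : p 7 1%N = 0 by apply: nz_roots => // x /p_eq0 [].
have p2 : p 7 2%N = 0 by apply: nz_roots => // x /p_eq0 [].
(* The degree may be 7 here, so the seven nonzero roots do not suffice; the origin supplies the root
   0. *)
have p0 : p 8 0%N = 0.
  apply: (@poly_many_roots0 _ _ (enum F)).
  - exact: enum_uniq.
  - apply/allP => x _; rewrite /root; have [-> | /p_eq0 [-> //]] := eqVneq x 0.
    have := ev0 0 0; rewrite sumE p1 p2 !horner0 !mul0r !addr0 => -> //.
    by rewrite /on_curve !expr0n /= mul0r !addr0.
  - by rewrite -cardE cardF size_poly.
have coefp n j i : p n j = 0 -> (i < n)%N -> a (i, j) = 0.
  move=> /(congr1 (coefp i)) /= + lt_in.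
  by rewrite coef_poly coef0 lt_in.
move=> [i j]; rewrite !mem_cat => /or3P [] /mapP[k];
  rewrite mem_iota /= => ltk [-> ->].
- exact: coefp p0 ltk.
- exact: coefp p1 ltk.
- exact: coefp p2 ltk.
Qed.

Variable P : 'I_22 -> 2.-tuple F.
Hypothesis P_onto : codom P =i klein_variety F.

Definition evmon (m : nat * nat) : 'rV[F]_22 :=
  \row_i (tnth (P i) iX ^+ m.1 * tnth (P i) iY ^+ m.2).

Lemma on_curveP (x y : F) :
  on_curve x y -> exists i, tnth (P i) iX = x /\ tnth (P i) iY = y.
Proof.
move=> xy; have : [tuple x; y] \in codom P.
  by rewrite P_onto mem_klein_variety // !(tnth_nth 0).
by case/codomP => i e; exists i; rewrite -e !(tnth_nth 0).
Qed.

Lemma P_on_curve i : on_curve (tnth (P i) iX) (tnth (P i) iY).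
Proof. by rewrite -mem_klein_variety // -P_onto codom_f. Qed.

Definition eval_mx : 'M[F]_22 := \matrix_k evmon (nth (0, 0)%N deltas k).

Lemma eval_mx_unit : eval_mx \in unitmx.
Proof.
rewrite -row_free_unit; apply: inj_row_free => v vE0.
pose a m := v 0 (inord (index m deltas)).
have a0 : {in deltas, forall m, a m = 0}.
  apply: deltas_independent => x y /on_curveP [i [<- <-]].
  rewrite (big_nth (0, 0)%N) big_mkord.
  have := congr1 (fun w : 'rV[F]_22 => w 0 i) vE0; rewrite !mxE => e.
  rewrite -[RHS]e; apply: eq_bigr => k _.
  by rewrite /a index_uniq // inord_val !mxE.
apply/rowP => k; rewrite mxE -(a0 (nth (0, 0)%N deltas k)) ?mem_nth //.
by rewrite /a index_uniq // inord_val.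
Qed.

(** The linear form that reads off the coordinate along [m] in the basis [deltas]. *)
Definition coord_mx (m : nat * nat) : 'cV[F]_22 :=
  invmx eval_mx *m delta_mx (inord (index m deltas)) 0.

Lemma index_deltas m : m \in deltas -> (index m deltas < 22)%N.
Proof. by move=> mD; rewrite -[22%N]/(size deltas) index_mem. Qed.

Lemma coord_mxE m n : m \in deltas -> n \in deltas ->
  evmon n *m coord_mx m = (n == m)%:R%:M.
Proof.
move=> mD nD.
have -> : evmon n = delta_mx 0 (inord (index n deltas)) *m eval_mx.
  by rewrite -rowE rowK inordK ?nth_index ?index_deltas.
rewrite mulmxA mulmxK ?eval_mx_unit //.
rewrite -(inj_in_eq (@index_inj _ (0, 0)%N deltas) nD mD).
move: (index m _) (index n _) (index_deltas mD) (index_deltas nD).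
move=> a b a22 b22.
rewrite mul_delta_mx_cond -val_eqE /= !inordK //.
apply/matrixP => i j; rewrite !ord1.
by case: (_ == _); rewrite ?mulr1n ?mulr0n !mxE.
Qed.

End Coordinates.

(** * The functionals phi_l and the weight bound *)

Lemma nth_find_iota (a : pred nat) n :
  has a (iota 0 n) -> a (find a (iota 0 n)).
Proof.
move=> ha; have := nth_find 0 ha; rewrite nth_iota ?add0n //.
by rewrite -[X in _ < X](size_iota 0) -has_find.
Qed.

Lemma before_find_iota (a : pred nat) n l :
  l < find a (iota 0 n) -> a l = false.
Proof.
move=> lt_l; rewrite -[RHS](before_find 0 lt_l) nth_iota //.
by rewrite (leq_trans lt_l) // -[X in _ <= X](size_iota 0) find_size.
Qed.

Lemma flag_lead_bit p : flag_lead p < 22 -> flag_bit p (flag_lead p).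
Proof.
by move=> lt22; apply: nth_find_iota; rewrite has_find size_iota.
Qed.

Lemma flag_bit_lt_lead p l : l < flag_lead p -> flag_bit p l = false.
Proof. exact: before_find_iota. Qed.

Section Functionals.
Set Implicit Arguments.
Unset Strict Implicit.
Import GRing.Theory.
Local Open Scope ring_scope.

Variable F : finFieldType.
Hypothesis cardF : #|F| = 8%N.
Variable P : 'I_22 -> 2.-tuple F.
Hypothesis P_onto : codom P =i klein_variety F.

Local Notation pchar2 := (pchar2 cardF).
Local Notation evmon := (evmon P).

Lemma evmon_curve a b :
  evmon (a, b.+3) = evmon (a + 3, b.+1)%N + evmon (a.+1, b).
Proof.
apply/rowP => i; rewrite !mxE /=; set x := tnth _ iX; set y := tnth _ iY.
have /eqP y3 : y ^+ 3 == x ^+ 3 * y + x.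
  rewrite -subr_eq0 (oppr_pchar2 pchar2) addrA.
  by have := P_on_curve cardF P_onto i.
by rewrite -(addn3 b) exprD y3 exprD !exprS; ring.
Qed.

(** Where x <> 0, x^7 = 1; at the origin both monomials vanish because [0 < a + b]. *)
Lemma evmon_add7 a b k : (0 < a + b)%N -> evmon (k * 7 + a, b)%N = evmon (a, b).
Proof.
move=> ab0; apply/rowP => i; rewrite !mxE /= exprD exprM.
have := P_on_curve cardF P_onto i; set x := tnth _ iX; set y := tnth _ iY.
have [-> | x0 _] := eqVneq x 0; last first.
  by rewrite exprAC (expf7 cardF x0) expr1n mul1r.
rewrite /on_curve expr0n mul0r !addr0 expf_eq0 /= => /eqP ->.
case: a ab0 => [|a] ab0; rewrite !expr0n ?mulr0 //.
by rewrite -[b == 0%N]negbK -lt0n ab0 /= !mulr0.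
Qed.

(** The bound on [r] says that reduction never goes up in [prec_w], which [evmon_lower] relies
    on. *)
Lemma evmon_reduce a b : (b < 3)%N -> exists r,
  [/\ (r <= a)%N, (r, b) \in deltas, flag_pos r b = flag_pos a b &
      evmon (r, b) = evmon (a, b)].
Proof.
have delta1 j : (j < 2)%N -> (a %% 7, j.+1)%N \in deltas.
  move=> j2; have : (a %% 7 \in iota 0 7)%N by rewrite mem_iota ltn_pmod.
  move=> am; rewrite !mem_cat; case: j j2 => [|[]] // _.
    by rewrite [X in _ || (X || _)]map_f ?orbT.
  by rewrite [X in _ || (_ || X)]map_f ?orbT.
case: b => [|[|[|]]] // _.
- case: a {delta1} => [|a]; first by exists 0%N.
  (* Positive powers of X reduce to exponents 1 to 7, since X^7 differs from 1 at the origin. *)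
  exists (a %% 7).+1%N; split; rewrite ?ltnS ?leq_mod //= ?modn_mod //.
    by rewrite mem_cat map_f // mem_iota ltnS ltn_pmod.
  by rewrite [in RHS](divn_eq a 7) -addnS evmon_add7.
- exists (a %% 7)%N; split; rewrite ?leq_mod ?delta1 //= ?modn_mod //.
  by rewrite [in RHS](divn_eq a 7) evmon_add7 ?addn1.
- exists (a %% 7)%N; split; rewrite ?leq_mod ?delta1 //= ?modn_mod //.
  by rewrite [in RHS](divn_eq a 7) evmon_add7 ?addn2.
Qed.

(** This is phi_l, prescribed by its values on the basis [deltas]. *)
Definition flag_mx (l : nat) : 'cV[F]_22 :=
  \sum_(m <- deltas) (count_mem l (flag_pos m.1 m.2))%:R *: coord_mx P m.

(** [flag_pos] follows the reductions that [evmon] satisfies, so the case of [deltas] implies the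
    rest by induction on the Y-exponent. *)
Lemma evmon_flag m l :
  evmon m *m flag_mx l = (count_mem l (flag_pos m.1 m.2))%:R%:M.
Proof.
have base n : n \in deltas ->
    evmon n *m flag_mx l = (count_mem l (flag_pos n.1 n.2))%:R%:M.
  move=> nD; rewrite mulmx_sumr (bigD1_seq n) //= -scalemxAr coord_mxE // eqxx.
  rewrite scalemx1 big_seq_cond big1 ?addr0 // => q /andP[qD qn].
  rewrite -scalemxAr coord_mxE // eq_sym (negPf qn).
  by rewrite scale_scalar_mx mulr0 raddf0.
case: m => a b /=; elim/ltn_ind: b a => b IH a.
have [/(evmon_reduce a) [r [_ rD <- <-]] | ] := ltnP b 3; first exact: base.
case: b IH => [|[|[|b]]] // IH _.
rewrite evmon_curve mulmxDl !IH //; last by rewrite ltnS -addn2 leq_addr.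
by rewrite -raddfD -natrD -count_cat.
Qed.

Definition evpoly (p : seq (nat * nat)) : 'rV[F]_22 := \sum_(m <- p) evmon m.

Lemma natr_odd n : n%:R = (odd n)%:R :> F.
Proof.
rewrite -[in LHS](odd_double_half n) natrD -muln2 natrM.
by rewrite (pcharf0 pchar2) mulr0 addr0.
Qed.

Lemma evpoly_flag p l : (evpoly p *m flag_mx l) 0 0 = (flag_bit p l)%:R.
Proof.
rewrite /flag_bit -natr_odd count_flatten -map_comp sumnE big_map natr_sum.
rewrite mulmx_suml summxE; apply: eq_bigr => m _.
by rewrite evmon_flag mxE eqxx.
Qed.

Lemma evpoly_mul p q i : evpoly (pmul p q) 0 i = evpoly p 0 i * evpoly q 0 i.
Proof.
rewrite /evpoly /pmul !summxE big_allpairs_dep big_distrlr /=.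
by apply: eq_bigr => m _; apply: eq_bigr => n _; rewrite !mxE /= !exprD mulrACA.
Qed.

Lemma weight_ge_pivots d (c : 'rV[F]_22) :
    enough_pivots d -> c \in <<[seq evpoly p | p <- code_basis d]>>%VS ->
    c != 0 ->
  (d <= #|[set i | c 0%R i != 0%R]|)%N.
Proof.
move=> /allP enough cB c0.
set B := code_basis d in enough cB.
set X := [seq _ | _ <- B] in cB.
have cE : c = \sum_(i < size X) coord (in_tuple X) i c *: X`_i.
  exact: coord_span.
pose a i := coord (in_tuple X) i c.
have [i0 ai0] : exists i, a i != 0.
  apply/existsP; apply: contraNT c0; rewrite negb_exists => /forallP a0.
  rewrite cE big1 // => i _.
  by have := a0 i; rewrite negbK /a => /eqP ->; rewrite scale0r.
(* [i] is the leading generator of [c], as the generators come in increasing pole order. *)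
case: (@arg_maxnP _ i0 (fun i => a i != 0) (fun i => i : nat) ai0) => i ai imax.
have szX : size X = size B by rewrite size_map.
have iB : (i < size B)%N by rewrite -szX.
set n := size multipliers; pose L := leads d.
(* [K l] will index a multiplier that makes generator [i] lead at [l] and every earlier generator
   lead strictly after [l]. *)
pose Q l k := [&& nth 0%N (nth [::] L i) k == l, (l < 22)%N &
  all (fun j => (l < nth 0 (nth [::] L j) k)%N) (iota 0 i)].
pose K l := find (Q l) (iota 0 n).
pose s := sort leq (pivots L i).
have sQ l : l \in s -> Q l (K l) /\ (K l < n)%N.
  rewrite mem_sort mem_undup => /mapP [k].
  rewrite mem_filter => /andP[kQ kn] lk.
  have hasQ : has (Q l) (iota 0 n).
    by apply/hasP; exists k => //; rewrite /Q lk eqxx.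
  by split; [exact: nth_find_iota | rewrite -[n](size_iota 0) -has_find].
have LE j k : (j < size B)%N -> (k < n)%N ->
    nth 0%N (nth [::] L j) k =
    flag_lead (pmul (nth [::] B j) (nth [::] multipliers k)).
  by move=> jB kn; rewrite (nth_map [::]) // (nth_map [::]).
have cgE l k : (k < n)%N ->
    \sum_j c 0 j * evpoly (nth [::] multipliers k) 0 j * flag_mx l j 0 =
    \sum_j a j * (flag_bit (pmul (nth [::] B j) (nth [::] multipliers k)) l)%:R.
  move=> kn; transitivity (\sum_j \sum_p
     a j * (evpoly (pmul (nth [::] B j) (nth [::] multipliers k)) 0 p *
            flag_mx l p 0)).
    rewrite exchange_big; apply: eq_bigr => p _ /=.
    rewrite [in LHS]cE summxE !mulr_suml; apply: eq_bigr => j _.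
    by rewrite mxE (nth_map [::]) -?szX // evpoly_mul -!mulrA.
  by apply: eq_bigr => j _; rewrite -mulr_sumr -evpoly_flag mxE.
(* Up to position [l] only generator [i] contributes: later ones have coefficient 0 in [c], and
   products of earlier ones have no bit there. *)
have cg l k : l \in s -> (k <= l)%N ->
    \sum_j c 0 j * evpoly (nth [::] multipliers (K l)) 0 j * flag_mx k j 0 =
    a i * (k == l)%:R.
  move=> /sQ [/and3P[/eqP Ll l22 /allP low] Kn] le_kl.
  rewrite cgE // (bigD1 i) //= big1 ?addr0 => [|j ji].
    move: Ll; rewrite LE // => Ll.
    move: le_kl; rewrite leq_eqVlt => /predU1P [-> | lt_kl].
      by rewrite eqxx -[X in flag_bit _ X]Ll flag_lead_bit // Ll.
    by rewrite flag_bit_lt_lead ?Ll // ltn_eqF.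
  have [lt_ij | lt_ji | /val_inj eq_ij] := ltngtP i j.
  - have /eqP -> : a j == 0 by apply: contraTT lt_ij => /imax; rewrite -leqNgt.
    by rewrite mul0r.
  - rewrite flag_bit_lt_lead ?mulr0 //; apply: leq_ltn_trans le_kl _.
    by rewrite -LE -?szX //; apply: low; rewrite mem_iota.
  - by rewrite eq_ij eqxx in ji.
have /leq_trans -> // : (d <= size s)%N.
  rewrite size_sort; apply: enough.
  by rewrite mem_iota (_ : size (leads d) = size B) ?iB ?size_map.
apply: (@weight_ge_triangular _ _ c s flag_mx
         (fun l => evpoly (nth [::] multipliers (K l)))).
- by rewrite ltn_sorted_uniq_leq sort_uniq undup_uniq sort_sorted //;
     exact: leq_total.
- by move=> l ls /=; rewrite cg // eqxx mulr1.
- by move=> l k ls _ lt_kl; rewrite cg 1?ltnW // ltn_eqF // mulr0.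
Qed.

(** The check exhibits [m] as a generator minus monomials that are generators themselves. *)
Lemma evmon_in_code_basis d m : spans_code d -> m \in code_mons d ->
  evmon m \in <<[seq evpoly p | p <- code_basis d]>>%VS.
Proof.
move=> /allP sp /sp /hasP [p pB /andP[mp /allP rest]].
have -> : evmon m = evpoly p - \sum_(n <- rem m p) evmon n.
  by rewrite /evpoly (perm_big _ (perm_to_rem mp)) big_cons addrK.
apply: rpredB; first by rewrite memv_span ?map_f.
rewrite big_seq; apply: rpred_sum => n /rest nB.
by rewrite memv_span //; apply/mapP; exists [:: n]; rewrite // /evpoly big_seq1.
Qed.

End Functionals.

(** * The footprint of the ideal *)

Section Footprint.
Set Implicit Arguments.
Unset Strict Implicit.
Import GRing.Theory.
Local Open Scope ring_scope.

Definition exponents (m : 'X_{1..2}) : nat * nat := (m iX, m iY).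

Definition bimon (a b : nat) : 'X_{1..2} :=
  [multinom (if i == iX then a else b) | i < 2].

Lemma exponentsK (m : 'X_{1..2}) : bimon (m iX) (m iY) = m.
Proof.
apply/mnmP => i; rewrite mnmE; case: eqP => [-> // | iNX].
suff -> : i = iY by [].
case: i iNX => -[|[|//]] i2 iNX; apply: val_inj => //.
by case: iNX; apply: val_inj.
Qed.

Lemma bimonK a b : exponents (bimon a b) = (a, b).
Proof. by rewrite /exponents !mnmE. Qed.

Lemma mpolyX_bimon (R : comNzRingType) a b :
  'X_[bimon a b] = 'X_iX ^+ a * 'X_iY ^+ b :> {mpoly R[2]}.
Proof.
rewrite mpolyXE_id big_ord_recl big_ord1 /= !mnmE /=.
by congr ('X_ _ ^+ _ * 'X_ _ ^+ _); apply: val_inj.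
Qed.

Lemma prec_w_bimon a b c d : prec_w (bimon a b) (bimon c d) =
  (2 * a + 3 * b < 2 * c + 3 * d)%N ||
  (2 * a + 3 * b == 2 * c + 3 * d)%N && (b < d)%N.
Proof. by rewrite /prec_w /wdeg !mnmE. Qed.

Lemma is_lead_monX (F : finFieldType) m (g : {mpoly F[2]}) :
  {in msupp g, forall n, prec_w n m} -> is_lead_mon ('X_[m] + g) m.
Proof.
move=> gm; split=> [|n /msuppD_le].
  rewrite mcoeff_msupp mcoeffD mcoeffX eqxx memN_msupp_eq0 ?addr0 ?oner_neq0 //.
  by apply/negP => /gm; rewrite /prec_w !ltnn andbF.
by rewrite mem_cat msuppX inE => /orP[-> // | /gm].
Qed.

Variable F : finFieldType.
Hypothesis cardF : #|F| = 8%N.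

Lemma klein_idealMl (g f : {mpoly F[2]}) : klein_ideal f -> klein_ideal (g * f).
Proof.
move=> [a [b [c ->]]]; exists (g * a), (g * b), (g * c).
by rewrite !mulrDr !mulrA.
Qed.

Lemma klein_ideal_X8 : klein_ideal ('X_iX ^+ 8 + 'X_iX : {mpoly F[2]}).
Proof. by exists 0, 1, 0; rewrite !mul0r mul1r add0r addr0. Qed.

Lemma klein_ideal_X7Y : klein_ideal ('X_iX ^+ 7 * 'X_iY + 'X_iY : {mpoly F[2]}).
Proof.
set X := 'X_iX; set Y := 'X_iY.
(* Modulo the quartic, Y^8 = X^6 Y^4 + X^2 Y^2 and Y^4 = X^3 Y^2 + X Y, so Y^8 + Y becomes X^7 Y + Y
   + X Y^2 (X^8 + X). *)
exists (Y ^+ 2 * klein_quartic F + X ^+ 6 * Y), (X * Y ^+ 2), 1.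
apply/eqP; rewrite -subr_eq0 /klein_quartic -/X -/Y; apply/eqP.
pose s := Y ^+ 8 + X ^+ 6 * Y ^+ 4 + X ^+ 2 * Y ^+ 2 + X ^+ 9 * Y ^+ 2 +
  X ^+ 3 * Y ^+ 6 + X * Y ^+ 5 + X ^+ 4 * Y ^+ 3.
transitivity (- (s + s)); first by rewrite /s; ring.
by rewrite -mulr2n -scaler_nat (pcharf0 (pchar2 cardF)) scale0r oppr0.
Qed.

(** A monomial outside [deltas] is a multiple of Y^3, X^8 or X^7 Y, each leading in the ideal; Y^3
    ties with X^3 Y in weight and wins by its Y-exponent. *)
Lemma footprint_deltas m : footprint F m -> exponents m \in deltas.
Proof.
rewrite -{1}(exponentsK m) /exponents; set a := m iX; set b := m iY.
apply: contraPT => abD; apply.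
have [b3 | b3] := leqP 3 b.
  exists ('X_[bimon a (b - 3)] * klein_quartic F); split.
    exact/klein_idealMl/klein_ideal_quartic.
  have -> : 'X_[bimon a (b - 3)] * klein_quartic F =
     'X_[bimon a b] + ('X_[bimon (a + 3) (b - 3).+1] + 'X_[bimon a.+1 (b - 3)]).
    rewrite !mpolyX_bimon -{2}(subnK b3) /klein_quartic !exprD !exprS; ring.
  apply: is_lead_monX => n /msuppD_le; rewrite mem_cat !msuppX !inE.
  by case/orP => /eqP ->; rewrite prec_w_bimon; lia.
have [b0 | b0] := eqVneq b 0%N.
  have a8 : (8 <= a)%N.
    rewrite leqNgt; apply: contra abD => a8.
    by rewrite b0 mem_cat map_f // mem_iota.
  exists ('X_[bimon (a - 8) 0] * ('X_iX ^+ 8 + 'X_iX)); split.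
    exact/klein_idealMl/klein_ideal_X8.
  have -> : 'X_[bimon (a - 8) 0] * ('X_iX ^+ 8 + 'X_iX) =
      'X_[bimon a b] + 'X_[bimon (a - 8).+1 0] :> {mpoly F[2]}.
    rewrite b0 !mpolyX_bimon -{2}(subnK a8) !exprD !exprS; ring.
  apply: is_lead_monX => n; rewrite msuppX inE => /eqP ->.
  by rewrite b0 prec_w_bimon; lia.
have a7 : (7 <= a)%N.
  rewrite leqNgt; apply: contra abD => a7; rewrite !mem_cat.
  have ai : a \in iota 0 7 by rewrite mem_iota.
  case: b b3 b0 => [|[|[|]]] // _ _.
    by rewrite [X in _ || (X || _)]map_f ?orbT.
  by rewrite [X in _ || (_ || X)]map_f ?orbT.
exists ('X_[bimon (a - 7) b.-1] * ('X_iX ^+ 7 * 'X_iY + 'X_iY)); split.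
  exact/klein_idealMl/klein_ideal_X7Y.
have -> : 'X_[bimon (a - 7) b.-1] * ('X_iX ^+ 7 * 'X_iY + 'X_iY) =
    'X_[bimon a b] + 'X_[bimon (a - 7) b] :> {mpoly F[2]}.
  rewrite !mpolyX_bimon -{2}(subnK a7); case: (b) b0 => // b' _.
  by rewrite !exprD !exprS /=; ring.
apply: is_lead_monX => n; rewrite msuppX inE => /eqP ->.
by rewrite prec_w_bimon; lia.
Qed.

Variable P : 'I_22 -> 2.-tuple F.
Hypothesis P_onto : codom P =i klein_variety F.

Lemma ev_mpolyX m : ev P 'X_[m] = evmon P (exponents m).
Proof.
apply/rowP => i; rewrite !mxE mevalX big_ord_recl big_ord1 /=.
by rewrite (_ : lift ord0 ord0 = iY) //; apply: val_inj.
Qed.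

(** Each reduction step yields monomials that are no higher in [prec_w], so the expansion in
    [deltas] never reaches [m]. *)
Lemma evmon_lower (m : nat * nat) a b : m \in deltas ->
    prec_w (bimon a b) (bimon m.1 m.2) -> evmon P (a, b) *m coord_mx P m = 0.
Proof.
move=> mD; rewrite prec_w_bimon; elim/ltn_ind: b a => b IH a lt_m.
have [/(evmon_reduce cardF P_onto a) [r [ra rD _ <-]] | ] := ltnP b 3.
  rewrite (coord_mxE cardF P_onto) //.
  case: eqP => [e | _]; last by rewrite raddf0.
  by move: lt_m; rewrite -e /=; lia.
case: b IH lt_m => [|[|[|b]]] // IH lt_m _.
by rewrite (evmon_curve cardF P_onto) mulmxDl !IH ?addr0 //; lia.
Qed.

(** An element of the ideal evaluates to 0, yet its coordinate along a leading monomial in [deltas]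
    is the coefficient of that monomial, as all its other monomials are lower. *)
Lemma deltas_footprint m : exponents m \in deltas -> footprint F m.
Proof.
move=> mD [f [If [mf f_lead]]].
have : ev P f *m coord_mx P (exponents m) = 0.
  rewrite (@ev_klein_ideal _ _ P f 0) ?subr0 //.
    rewrite [ev _ _](_ : _ = 0) ?mul0mx //.
    by apply/rowP => i; rewrite !mxE meval0.
  by move=> i; rewrite -P_onto codom_f.
have -> : ev P f = \sum_(n <- msupp f) f@_n *: ev P 'X_[n].
  apply/rowP => i; rewrite mxE {1}(mpolyE f) raddf_sum summxE /=.
  by apply: eq_bigr => n _; rewrite !mxE mevalZ.
rewrite mulmx_suml (bigD1_seq m) ?msupp_uniq //= big_seq_cond big1.
  rewrite addr0 ev_mpolyX -scalemxAl (coord_mxE cardF P_onto) // eqxx scalemx1.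
  move=> /(congr1 (fun A : 'M_1 => A 0 0)); rewrite !mxE eqxx => /eqP.
  by rewrite mulr1n -[_ == 0]negbK -mcoeff_msupp mf.
move=> n /andP[nf nm]; rewrite -scalemxAl ev_mpolyX evmon_lower ?scaler0 //.
by rewrite !exponentsK f_lead.
Qed.

(** * Dimension and minimum distance of the codes *)

Lemma codeE d : code P d = <<[seq evmon P m | m <- code_mons d]>>%VS.
Proof.
apply/eqP; rewrite eqEsubv; apply/andP; split; apply/span_subvP => v.
  rewrite mem_filter => /andP[/asboolP [m [/footprint_deltas mD dm ->]] _].
  rewrite ev_mpolyX; apply/memv_span/map_f.
  by rewrite mem_filter; apply/andP.
case/mapP => -[a b]; rewrite mem_filter => /andP[dm mD ->].
apply: memv_span; rewrite mem_filter; apply/andP.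
split; last by rewrite mem_enum memvf.
apply/asboolP.
exists (bimon a b); split; last by rewrite ev_mpolyX bimonK.
  by apply: deltas_footprint; rewrite bimonK.
by rewrite /delta !mnmE.
Qed.

Lemma evmon_free s : uniq s -> {subset s <= deltas} -> free (map (evmon P) s).
Proof.
elim: s => [|m s IH] /= => [_ _|/andP[ms us] sD]; first by rewrite nil_free.
have mD : m \in deltas by rewrite sD ?mem_head.
rewrite free_cons IH ?andbT // => [|n ns]; last by rewrite sD // inE ns orbT.
apply/negP => /(coord_span (X := in_tuple (map (evmon P) s))).
move=> /(congr1 (fun v => (v *m coord_mx P m) 0 0)) /eqP.
rewrite (coord_mxE cardF P_onto) // eqxx mulmx_suml.
rewrite big1 ?mxE ?oner_eq0 // => i _.
have i_s : (i < size s)%N by rewrite -(size_map (evmon P)).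
have nm : nth (0, 0)%N s i != m by apply: contraNneq ms => <-; rewrite mem_nth.
rewrite -scalemxAl (nth_map (0, 0)%N) // (coord_mxE cardF P_onto) //.
  by rewrite (negPf nm) raddf0 scaler0.
by rewrite sD // inE mem_nth ?orbT.
Qed.

Lemma dim_code d : \dim (code P d) = size (code_mons d).
Proof.
rewrite codeE -(size_map (evmon P)); apply/eqnP/evmon_free.
  by rewrite filter_uniq.
by move=> m; rewrite mem_filter => /andP[].
Qed.

Lemma min_dist_code d : (d <= 22)%N -> spans_code d -> enough_pivots d ->
  (d <= min_dist (code P d))%N.
Proof.
(* [d22] settles the default value 22 of the minimum. *)
move=> d22 sp piv; rewrite -leEnat; apply: Order.POrderTheory.le_bigmin => //.
move=> [u v] /= /and3P[uC vC uv]; rewrite leEnat.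
have -> : hamming_dist u v = #|[set i | (u - v) 0%R i != 0%R]|.
  by apply: eq_card => i; rewrite !inE !mxE subr_eq0.
apply: (weight_ge_pivots cardF P_onto piv); last by rewrite subr_eq0.
have : u - v \in code P d by rewrite rpredB.
apply: subvP; rewrite codeE; apply/span_subvP => _ /mapP[m mC ->].
exact: evmon_in_code_basis.
Qed.

End Footprint.

Theorem mainTheorem1 (F : finFieldType) (cardF : #|F| = 8) :
  #|klein_variety F| = 22 /\
  (forall P : 'I_22 -> 2.-tuple F,
     injective P -> codom P =i klein_variety F ->
   forall k d : nat,
     (k, d) \in [:: (1, 22); (2, 19); (3, 18); (4, 16); (5, 15); (7, 13);
                    (8, 12); (10, 10); (11, 9); (13, 7); (14, 6); (15, 5);
                    (17, 4); (18, 3); (20, 2)] ->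
     \dim (code P d) = k /\ d <= min_dist (code P d)).
Proof.
split=> [|P _ P_onto k d]; first exact: card_klein_variety.
move/(allP codes_checked)/and4P => [/= /eqP szC d22 sp piv].
by rewrite dim_code //; split=> //; apply: min_dist_code.
Qed.
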